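(* The lifted-EPIs are facet-defining for $\mathrm{conv}(\mathcal{P}^2_k)$. That is, for every permutation $\delta$ of $N$, the lifted-EPI $w\ge\sum_{i\in N}\zeta_ix_i$ associated with $\delta$ (with base set $S=\{\delta_1,\dots,\delta_k\}$) is valid for and defines a facet of $\mathrm{conv}(\mathcal{P}^2_k)$.
   Context: $N=\{1,\dots,n\}$, $1\le k\le n$, and $f:\mathbb{R}\to\mathbb{R}$ is concave with $f(0)=0$. The weight vector $a\in\mathbb{R}^n_+$ has exactly two distinct values $0\le a_L<a_H$. The set is $\mathcal{P}^2_k=\{(w,x)\in\mathbb{R}\times\{0,1\}^n: w\ge f(\sum_{i=1}^n a_ix_i),\ \sum_{i=1}^nx_i\le k\}$. Given a permutation $\delta=(\delta_1,\dots,\delta_n)$ of $N$, the associated lifted-EPI is the inequality $w\ge\sum_{j=1}^n\zeta_{\delta_j}x_{\delta_j}$ obtained by exact sequential lifting of an extended polymatroid inequality: for $j\le k$, $\zeta_{\delta_j}=f(\sum_{i=1}^ja_{\delta_i})-f(\sum_{i=1}^{j-1}a_{\delta_i})$; and for $j=k+1,\dots,n$, recursively, $$\zeta_{\delta_j}=\min\Big\{f\Big(a_{\delta_j}+\sum_{i\in X}a_i\Big)-\sum_{i\in X}\zeta_i\ :\ X\subseteq\{\delta_1,\dots,\delta_{j-1}\},\ |X|\le k-1\Big\}.$$ *)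

(* Defs.v *)
(* MathComp / MathComp-Analysis, over an arbitrary R : realType. *)
From HB Require Import structures.
From mathcomp Require Import all_boot all_order all_algebra all_fingroup.
From mathcomp Require Import boolp classical_sets reals convex.

Set Implicit Arguments.
Unset Strict Implicit.
Unset Printing Implicit Defensive.

Import Order.TTheory GRing.Theory Num.Theory.

Local Open Scope classical_set_scope.
Local Open Scope ring_scope.

Definition concave (R : realType) (f : R -> R) : Prop :=
  convex_function [set: convex_lmodType R^o] (fun x => - f x).

Definition convhull (R : realType) (V : lmodType R) (A : set V) : set V :=
  smallest (@convex_set R V) A.

Definition aff_indep (R : realType) (V : vectType R) (s : seq V) : bool :=
  if s is v0 :: s' then free [seq v - v0 | v <- s'] else true.

(* A has affine dimension d: the largest number of affinely independent points
   of A is d + 1; in particular A is nonempty. *)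
Definition has_dim (R : realType) (V : vectType R) (A : set V) (d : nat) : Prop :=
  (exists s : seq V,
     [/\ size s = d.+1, forall v, v \in s -> A v & aff_indep s]) /\
  (forall s : seq V,
     (forall v, v \in s -> A v) -> aff_indep s -> (size s <= d.+1)%N).

Definition valid_ineq (R : realType) (V : vectType R) (C : set V)
  (l r : V -> R) : Prop := forall p, C p -> l p <= r p.

(* For an inequality l <= r that is valid for C. *)
Definition facet_defining (R : realType) (V : vectType R) (C : set V)
    (l r : V -> R) : Prop :=
  exists d : nat, has_dim C d.+1 /\ has_dim (C `&` [set p | l p = r p]) d.

(* A point (w, x) is a pair p with p.1 = w and p.2 = x. R^o is R regarded as a
   vector space over itself. *)
Definition P2 (R : realType) (n : nat) (f : R -> R) (a : 'I_n -> R) (k : nat) :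
    set (R^o * 'rV[R]_n) :=
  [set p : R^o * 'rV[R]_n | [/\ forall i, p.2 0 i = 0 \/ p.2 0 i = 1,
               f (\sum_i a i * p.2 0 i) <= p.1
             & \sum_i p.2 0 i <= k%:R]].

(* Positions are 0-based: delta j, for j : 'I_n, is the (j+1)-st element of the
   permutation, and prefix_set delta m is the set of its first m elements. *)
Definition prefix_set (n : nat) (delta : 'S_n) (m : nat) : {set 'I_n} :=
  [set delta j | j : 'I_n & (j < m)%N]%SET.

(* The coefficient of the variable i in 0-based position m, given the
   coefficients zeta of the first m variables. set0 is a feasible X, so the
   arg min is a minimiser over all feasible X. *)
Definition lifted_coef (R : realType) (n : nat) (f : R -> R) (a : 'I_n -> R)
    (k : nat) (delta : 'S_n) (m : nat) (zeta : 'I_n -> R) (i : 'I_n) : R :=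
  if (m < k)%N then
    f (\sum_(l in prefix_set delta m.+1) a l) - f (\sum_(l in prefix_set delta m) a l)
  else
    let v := fun X : {set 'I_n} =>
      f (a i + \sum_(l in X) a l) - \sum_(l in X) zeta l in
    v [arg min_(X < finset.set0 | (X \subset prefix_set delta m) && (#|X| <= k.-1)%N)
         v X]%O.

(* Coefficients after m steps; the variables not yet processed have
   coefficient 0. *)
Fixpoint zeta_upto (R : realType) (n : nat) (f : R -> R) (a : 'I_n -> R)
    (k : nat) (delta : 'S_n) (m : nat) : 'I_n -> R :=
  if m is m'.+1 then
    let zeta := zeta_upto f a k delta m' in
    fun i => if (delta^-1)%g i == m' :> nat
             then lifted_coef f a k delta m' zeta i
             else zeta i
  else fun=> 0.

Definition lifted_EPI (R : realType) (n : nat) (f : R -> R) (a : 'I_n -> R)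
    (k : nat) (delta : 'S_n) : 'I_n -> R :=
  zeta_upto f a k delta n.

(* Main.v *)
Require Import Defs.
From HB Require Import structures.
From mathcomp Require Import all_boot all_order all_algebra all_fingroup.
From mathcomp Require Import boolp classical_sets reals convex.
From mathcomp Require Import interval_inference ring lra.

Set Implicit Arguments.
Unset Strict Implicit.
Unset Printing Implicit Defensive.

Import Order.TTheory GRing.Theory Num.Theory.

Local Open Scope classical_set_scope.
Local Open Scope ring_scope.

(* Lifting is exact, so every coefficient keeps the inequality valid on the
   variables processed so far and makes it tight at some feasible set whose last
   element in the order delta is the new variable; for the first k variables
   validity comes from the decreasing differences of f, and the prefixes are
   tight.  These n tight points are triangular with respect to delta, hence
   together with the origin they are n + 1 affinely independent points of the
   face.  Adding the recession direction (1, 0) gives full dimension. *)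

(** * Decreasing differences of a concave function *)

(** Both [y] and [x + h] lie between [x] and [y + h], as convex combinations of these endpoints with
    swapped weights [t] and [1 - t]. Adding the two concavity inequalities cancels the weights. *)
Lemma concave_decreasing_diff (R : realType) (f : R -> R) (x y h : R) :
  concave f -> x <= y -> 0 <= h -> f (y + h) - f y <= f (x + h) - f x.
Proof.
move=> cf xy h0.
(* When the interval from [x] to [y + h] is a single point, the quotient defining [t] would have
   denominator 0. *)
have [d0|d0] := eqVneq (y - x + h) 0.
  have -> : y = x by lra.
  by [].
have dgt0 : 0 < y - x + h by rewrite lt_neqAle eq_sym d0/=; lra.
have cf' (t : R) : 0 <= t -> t <= 1 -> forall u v,
    t * f u + (1 - t) * f v <= f (t * u + (1 - t) * v).
  move=> t0 t1 u v.
  have : - f (t * u + (1 - t) * v) <= t * - f u + (1 - t) * - f v.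
    exact: (cf (Itv01 t0 t1) u v (mem_set I) (mem_set I)).
  lra.
set t := (y - x) / (y - x + h).
have t0 : 0 <= t by apply: divr_ge0; lra.
have t1 : t <= 1 by rewrite ler_pdivrMr//; lra.
have H1 := cf' t t0 t1 x (y + h).
have H2 := cf' t t0 t1 (y + h) x.
have E1 : t * x + (1 - t) * (y + h) = x + h by rewrite /t; field.
have E2 : t * (y + h) + (1 - t) * x = y by rewrite /t; field.
rewrite E1 in H1; rewrite E2 in H2; lra.
Qed.

(** * Size bounds for affinely independent families *)

Section AffineDimension.
Variables (R : realType) (V : vectType R).

Lemma aff_indep_size (s : seq V) : aff_indep s -> (size s <= (dim V).+1)%N.
Proof.
case: s => //= v0 s; rewrite /free size_map => /eqP <-.
by rewrite ltnS -dimvf dimvS// subvf.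
Qed.

(** All differences of the points lie in the kernel of [l] and [e] does not, so [e] can be added to
    the free family of differences; this improves the general bound by one. *)
Lemma aff_indep_hyperplane_size (l : {linear V -> R^o}) (e : V) (s : seq V) :
  l e != 0 -> (forall v, v \in s -> l v = 0) -> aff_indep s ->
  (size s <= dim V)%N.
Proof.
move=> le0; case: s => //= v0 s ls fs.
suff : free (e :: [seq v - v0 | v <- s]).
  by rewrite /free /= size_map => /eqP <-; rewrite -dimvf dimvS// subvf.
rewrite free_cons fs andbT; apply: contra le0 => es.
have : e \in lker (linfun l).
  apply: (subvP _ _ es); apply/span_subvP => _ /mapP[v vs ->].
  by rewrite memv_ker lfunE/= linearB/= !ls ?subrr// ?inE ?eqxx// vs orbT.
by rewrite memv_ker lfunE.
Qed.

Lemma spanning_free (X : seq V) :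
  size X = dim V -> (fullv <= <<X>>)%VS -> free X.
Proof.
move=> sX fX; rewrite /free eqn_leq dim_span/= sX -dimvf.
exact: dimvS.
Qed.

End AffineDimension.

(** * Convex hulls and half-spaces *)

Section ConvexHull.
Variables (R : realType) (V : lmodType R).

Lemma convhull_sub (A : set V) : A `<=` convhull A.
Proof. exact: sub_smallest. Qed.

Lemma convhull_le0 (A : set V) (l : {linear V -> R^o}) :
  (forall v, A v -> l v <= 0) -> forall v, convhull A v -> l v <= 0.
Proof.
move=> lA; apply: (@smallest_sub _ (@convex_set R V) A [set v | l v <= 0]) => //.
move=> x y t; rewrite !inE/= => lx ly; rewrite linearD !linearZ/=.
have t0 : 0 <= t%:num by [].
have t1 : 0 <= 1 - t%:num by rewrite subr_ge0.
by rewrite -oppr_ge0 opprD addr_ge0// -mulrN mulr_ge0// oppr_ge0.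
Qed.

End ConvexHull.

(** * The recursion for the lifted coefficients *)

Section LiftedEPI.
Variables (R : realType) (n k : nat) (f : R -> R) (a : 'I_n -> R).
Variable delta : 'S_n.
Hypotheses (k_gt0 : (0 < k)%N) (cf : concave f) (f0 : f 0 = 0).
Hypothesis a_ge0 : forall i, 0 <= a i.

Local Notation zeta := (lifted_EPI f a k delta).
Local Notation prefix := (prefix_set delta).

Lemma in_prefix_set m i : (i \in prefix m) = ((delta^-1)%g i < m)%N.
Proof.
apply/imsetP/idP => [[j jm ->]|im]; first by rewrite permK inE in jm *.
by exists ((delta^-1)%g i); rewrite ?permKV ?inE.
Qed.

Lemma perm_notin_prefix (j : 'I_n) : delta j \notin prefix j.
Proof. by rewrite in_prefix_set permK ltnn. Qed.

Lemma prefix_setS (j : 'I_n) : prefix j.+1 = (delta j |: prefix j)%SET.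
Proof.
apply/setP => i; rewrite !inE !in_prefix_set ltnS leq_eqVlt; congr (_ || _).
by rewrite -[in RHS](permKV delta i) (inj_eq perm_inj).
Qed.

Lemma card_prefix m : (#|prefix m| <= m)%N.
Proof.
elim: m => [|m IH].
  by rewrite leqn0 cards_eq0; apply/eqP/setP=> i; rewrite in_prefix_set inE.
have [mn|nm] := ltnP m n.
  by rewrite (prefix_setS (Ordinal mn)) cardsU1 -add1n leq_add// leq_b1.
suff -> : prefix m.+1 = prefix m by apply: leqW.
apply/setP => i; rewrite !in_prefix_set !(leq_trans (ltn_ord _))//.
exact: leqW.
Qed.

(** A step changes only the coefficient of the variable it processes, so the partial coefficients in
    the recursion can be replaced by the final ones. *)
Lemma zeta_upto_stable m m' i : (m <= m')%N -> i \in prefix m ->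
  zeta_upto f a k delta m' i = zeta_upto f a k delta m i.
Proof.
rewrite in_prefix_set => mm' im; elim: m' mm' => [|m' IH].
  by rewrite leqn0 => /eqP ->.
rewrite leq_eqVlt => /predU1P[<-//|]; rewrite ltnS => mm' /=.
by rewrite ltn_eqF ?IH// (leq_trans im).
Qed.

Lemma sum_zeta_upto m (X : {set 'I_n}) : (m <= n)%N -> X \subset prefix m ->
  \sum_(i in X) zeta_upto f a k delta m i = \sum_(i in X) zeta i.
Proof.
move=> mn /fintype.subsetP Xm; apply: eq_bigr => i /Xm im.
by rewrite /lifted_EPI (zeta_upto_stable mn).
Qed.

Lemma lifted_EPI_rec (j : 'I_n) :
  zeta (delta j) =
  lifted_coef f a k delta j (zeta_upto f a k delta j) (delta j).
Proof.
rewrite /lifted_EPI (@zeta_upto_stable j.+1)//=; first by rewrite permK eqxx.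
by rewrite in_prefix_set permK.
Qed.

Lemma lifted_EPI_base (j : 'I_n) : (j < k)%N ->
  zeta (delta j) = f (\sum_(i in prefix j.+1) a i) - f (\sum_(i in prefix j) a i).
Proof. by move=> jk; rewrite lifted_EPI_rec /lifted_coef jk. Qed.

(** The minimum is attained, which will give tightness, and is a lower bound, which will give
    validity. *)
Lemma lifted_EPI_lift (j : 'I_n) : (k <= j)%N ->
  (exists X : {set 'I_n}, [/\ X \subset prefix j, (#|X| < k)%N &
    zeta (delta j) = f (a (delta j) + \sum_(i in X) a i) - \sum_(i in X) zeta i]) /\
  (forall X : {set 'I_n}, X \subset prefix j -> (#|X| < k)%N ->
    zeta (delta j) <= f (a (delta j) + \sum_(i in X) a i) - \sum_(i in X) zeta i).
Proof.
move=> kj; rewrite lifted_EPI_rec /lifted_coef ltnNge kj /=.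
have jn := ltnW (ltn_ord j).
case: arg_minP => [|X /andP[Xj Xk] Xmin]; first by rewrite finset.sub0set cards0.
split.
  exists X; split=> //; first by rewrite -(prednK k_gt0) ltnS.
  by rewrite -(sum_zeta_upto jn Xj).
move=> Y Yj Yk; rewrite -(sum_zeta_upto jn Yj); apply: Xmin.
by rewrite Yj -ltnS prednK.
Qed.

(** * Validity and tightness on feasible subsets *)

Lemma lifted_EPI_valid_prefix m (X : {set 'I_n}) :
  (m <= n)%N -> X \subset prefix m -> (#|X| <= k)%N ->
  \sum_(i in X) zeta i <= f (\sum_(i in X) a i).
Proof.
elim: m X => [|m IH] X mn Xm Xk.
  have -> : X = finset.set0.
    apply/eqP; rewrite -finset.subset0 (fintype.subset_trans Xm)//.
    by apply/fintype.subsetP => i; rewrite in_prefix_set.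
  by rewrite !big_set0 f0.
pose j := Ordinal mn; rewrite (prefix_setS j) in Xm.
have [jX|jX] := boolP (delta j \in X); last first.
  apply: IH => //; first exact: ltnW.
  apply/fintype.subsetP => i iX; have := fintype.subsetP Xm i iX.
  by rewrite in_setU1 => /predU1P[ij|//]; rewrite -ij iX in jX.
have X'm : X :\ delta j \subset prefix m by rewrite subDset.
have X'k : (#|X :\ delta j| < k)%N by rewrite (cardsD1 (delta j)) jX in Xk.
have {}IH := IH _ (ltnW mn) X'm (ltnW X'k).
rewrite !(big_setD1 (delta j) jX)/=.
(* For a lifted variable the minimum already bounds the whole sum; for a base variable the induction
   hypothesis is combined with decreasing differences. *)
have [mk|km] := ltnP m k; last first.
  by rewrite -lerBrDr (lifted_EPI_lift (j := j) km).2.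
rewrite (lifted_EPI_base (j := j) mk) prefix_setS big_setU1 ?perm_notin_prefix//=.
(* Weights are nonnegative, so the rest of [X] weighs at most the prefix containing it, and
   [delta j] raises [f] at least as much there as it does at the prefix. *)
have le_sum : \sum_(i in X :\ delta j) a i <= \sum_(i in prefix m) a i.
  rewrite [leRHS](big_setID (X :\ delta j))/= (finset.setIidPr X'm) lerDl.
  by apply: sumr_ge0.
have := concave_decreasing_diff cf le_sum (a_ge0 (delta j)).
rewrite ![_ + a _]addrC; lra.
Qed.

Lemma lifted_EPI_valid (X : {set 'I_n}) : (#|X| <= k)%N ->
  \sum_(i in X) zeta i <= f (\sum_(i in X) a i).
Proof.
apply: (@lifted_EPI_valid_prefix n) => //.
by apply/fintype.subsetP => i _; rewrite in_prefix_set.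
Qed.

Lemma lifted_EPI_tight (j : 'I_n) : exists T : {set 'I_n},
  [/\ T \subset prefix j.+1, delta j \in T, (#|T| <= k)%N &
      \sum_(i in T) zeta i = f (\sum_(i in T) a i)].
Proof.
have [jk|kj] := ltnP j k.
  exists (prefix j.+1); split => //.
  - by rewrite in_prefix_set permK.
  - exact: leq_trans (card_prefix _) jk.
  (* The base coefficients telescope along prefixes, by induction on the prefix length. *)
  have : (j.+1 <= n)%N by [].
  move: jk; elim: (j.+1) => [|m IH] mk mn.
    by rewrite !big_pred0 ?f0// => i; rewrite in_prefix_set.
  pose l := Ordinal mn; rewrite (prefix_setS l) big_setU1 ?perm_notin_prefix//=.
  by rewrite -prefix_setS (lifted_EPI_base (j := l) mk) IH ?(ltnW mk) ?(ltnW mn)// subrK.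
have [[X [Xj Xk zj]] _] := lifted_EPI_lift kj.
have jX : delta j \notin X.
  by apply: contra (perm_notin_prefix j); exact: (fintype.subsetP Xj).
exists (delta j |: X)%SET; split.
- by rewrite prefix_setS finset.setUS.
- by rewrite setU11.
- by rewrite cardsU1 jX.
- by rewrite !big_setU1//= zj subrK.
Qed.

(** * The inequality as a linear form, and 0/1 points as sets *)

Local Notation V := (R^o * 'rV[R]_n)%type.

(** The sign is opposite to the usual slack: validity reads [slack p <= 0], and the face is cut out
    by the kernel of this linear form. *)
Definition slack (p : V) : R^o := \sum_i zeta i * p.2 0 i - p.1.

Lemma slack_is_linear : linear slack.
Proof.
move=> c p q; rewrite /slack /GRing.scale/= mulrBr mulr_sumr opprD.
rewrite addrACA -big_split/=.
congr (_ + _); apply: eq_bigr => i _.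
by rewrite !mxE; ring.
Qed.

HB.instance Definition _ := GRing.isLinear.Build R V R^o *:%R slack slack_is_linear.

Definition indic (X : {set 'I_n}) : 'rV[R]_n := \row_i (i \in X)%:R.

Lemma sum_indic (b : 'I_n -> R) (X : {set 'I_n}) :
  \sum_i b i * indic X 0 i = \sum_(i in X) b i.
Proof.
rewrite [RHS]big_mkcond; apply: eq_bigr => i _.
by rewrite mxE mulr_natr mulrb.
Qed.

Lemma P2_indicP (X : {set 'I_n}) (w : R) :
  P2 f a k ((w, indic X) : V) <-> f (\sum_(i in X) a i) <= w /\ (#|X| <= k)%N.
Proof.
have sX : \sum_i indic X 0 i = #|X|%:R.
  under eq_bigr do rewrite -[indic _ _ _]mul1r.
  by rewrite (sum_indic (fun=> 1)) sumr_const.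
split=> [[_ /=]|[Xw Xk]]; rewrite ?sum_indic ?sX ?ler_nat//.
split=> /=; rewrite ?sum_indic ?sX ?ler_nat// => i.
by rewrite mxE; case: (_ \in _); [right|left].
Qed.

Lemma P2_indic (p : V) : P2 f a k p -> exists X w, p = (w, indic X).
Proof.
case: p => w x [/= x01 _ _]; exists [set i | x 0 i == 1]%SET, w; congr (_, _).
apply/rowP => i; rewrite mxE inE.
by case: (x01 i) => ->; rewrite ?eqxx// eq_sym oner_eq0.
Qed.

Lemma slack_P2_le0 (p : V) : P2 f a k p -> slack p <= 0.
Proof.
move=> Pp; have [X [w pE]] := P2_indic Pp; subst p.
have [Xw Xk] := (P2_indicP X w).1 Pp.
rewrite /slack/= sum_indic subr_le0.
exact: le_trans (lifted_EPI_valid Xk) Xw.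
Qed.

(** * Dimensions of the hull and of the face *)

Local Notation e0 := ((1, 0) : V).

Lemma dim_V : dim V = n.+1.
Proof. by rewrite -[dim V]/(1 + 1 * n)%N mul1n. Qed.

Lemma pair_basis (w : R) (x : 'rV[R]_n) :
  (w, x) = w *: e0 + \sum_i x 0 i *: ((0, delta_mx 0 i) : V).
Proof.
apply: injective_projections => /=.
  rewrite (raddf_sum fst) big1 ?addr0 => [|i _]/=; last exact: scaler0.
  by rewrite /GRing.scale/= mulr1.
by rewrite scaler0 add0r (raddf_sum snd)/= -row_sum_delta.
Qed.

Lemma tight_points : exists s : seq V,
  [/\ size s = n, forall p, p \in s -> P2 f a k p /\ slack p = 0 &
      free (e0 :: s)].
Proof.
have [T Tprop] := choice lifted_EPI_tight.
pose t j : V := (f (\sum_(i in T j) a i), indic (T j)).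
exists [seq t j | j : 'I_n]; split.
- by rewrite size_map -cardT card_ord.
- move=> _ /mapP[j _ ->]; have [_ _ Tk zT] := Tprop j; split.
    by apply/P2_indicP.
  by rewrite /slack/= sum_indic zT subrr.
(* There are n + 1 vectors in a space of dimension n + 1, so it suffices that they span. *)
apply: spanning_free; first by rewrite /= size_map -cardT card_ord dim_V.
set U := <<_>>%VS.
have e0U : e0 \in U by rewrite memv_span ?mem_head.
have eU (j : 'I_n) : ((0, delta_mx 0 (delta j)) : V) \in U.
  (* Triangular elimination by strong induction on the position: up to a multiple of [e0], [t j] is
     the unit vector of [delta j] plus unit vectors of earlier positions. *)
  have [m] := ubnP (j : nat); elim: m j => // m IH j; rewrite ltnS => jm.
  have [Tj jT _ _] := Tprop j.
  have tU : t j \in U.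
    by rewrite memv_span// inE orbC map_f ?mem_enum.
  have tE : t j = f (\sum_(i in T j) a i) *: e0 +
      \sum_(i in T j) ((0, delta_mx 0 i) : V).
    rewrite {1}/t pair_basis [in X in _ = _ + X]big_mkcond; congr (_ + _).
    by apply: eq_bigr => i _; rewrite mxE; case: ifP; rewrite (scale1r, scale0r).
  have -> : ((0, delta_mx 0 (delta j)) : V) = t j - f (\sum_(i in T j) a i) *: e0 -
     \sum_(i in T j :\ delta j) ((0, delta_mx 0 i) : V).
    by rewrite tE [X in _ + X - _ - _](big_setD1 _ jT)/= [X in X - _ - _]addrC !addrK.
  rewrite !memvB ?memvZ//; apply: memv_suml => i; rewrite !inE => /andP[ij iT].
  rewrite -(permKV delta i); apply: IH; apply: leq_trans jm.
  have := fintype.subsetP Tj i iT.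
  by rewrite prefix_setS in_setU1 (negbTE ij)/= in_prefix_set.
apply/subvP => -[w x] _.
rewrite pair_basis memvD ?memvZ//; apply: memv_suml => i _; rewrite memvZ//.
by rewrite -(permKV delta i).
Qed.

Lemma lifted_EPI_facet :
  valid_ineq (convhull (P2 f a k))
    (fun p : V => \sum_i zeta i * p.2 0 i) (fun p : V => p.1) /\
  facet_defining (convhull (P2 f a k))
    (fun p : V => \sum_i zeta i * p.2 0 i) (fun p : V => p.1).
Proof.
split=> [p Cp|].
  by rewrite -subr_le0 (convhull_le0 slack_P2_le0).
have [s [sn sP fs]] := tight_points.
(* The empty set supplies both the origin and [e0], since [f 0 = 0]. *)
have P0 w : 0 <= w -> P2 f a k ((w, 0) : V).
  have -> : 0 = indic finset.set0 by apply/rowP => i; rewrite !mxE inE.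
  by move=> w0; apply/P2_indicP; rewrite big_set0 f0 cards0.
(* The origin serves as base point, so affine independence of the families below is freeness of
   their other members. *)
have map0 (X : seq V) : [seq v - 0 | v <- X] = X.
  by rewrite -[RHS]map_id; apply: eq_map => v; rewrite subr0.
exists n; split; split.
- exists (0 :: e0 :: s); split; rewrite /= ?sn ?map0 ?subr0//.
  move=> v; rewrite !inE => /or3P[/eqP->|/eqP->|/sP[Pv _]]; apply: convhull_sub => //.
    exact: (P0 0).
  exact: (P0 1).
- by move=> r _ /aff_indep_size; rewrite dim_V.
- exists (0 :: s); split; rewrite /= ?sn ?map0//.
    move=> v; rewrite !inE => /predU1P[->|/sP[Pv sv]]; split => /=.
    + by apply: convhull_sub; apply: (P0 0).
    + by rewrite big1// => i _; rewrite mxE mulr0.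
    + exact: convhull_sub.
    + by apply/eqP; rewrite -subr_eq0 -/(slack v) sv.
  by move: fs; rewrite free_cons => /andP[].
(* The direction [e0] leaves the hyperplane of the face, as [slack e0] is -1. *)
move=> r rC rf; rewrite -dim_V; apply: (@aff_indep_hyperplane_size _ _ slack e0) => //.
  rewrite /= /slack big1 ?sub0r ?oppr_eq0 ?oner_eq0// => i _.
  by rewrite mxE mulr0.
by move=> v /rC[_ /= vE]; apply/eqP; rewrite /slack subr_eq0 vE.
Qed.

End LiftedEPI.

Theorem corollary3p6p1 (R : realType) (n k : nat) (f : R -> R)
    (a : 'I_n -> R) (aL aH : R) (delta : 'S_n)
    (hk : (1 <= k <= n)%N)
    (hf : concave f) (hf0 : f 0 = 0)
    (haL : 0 <= aL) (haLH : aL < aH)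
    (ha : range a = [set aL; aH]) :
  let zeta := lifted_EPI f a k delta in
  let C := convhull (P2 f a k) in
  let lhs := fun p : R^o * 'rV[R]_n => \sum_i zeta i * p.2 0 i in
  let rhs := fun p : R^o * 'rV[R]_n => p.1 in
  valid_ineq C lhs rhs /\ facet_defining C lhs rhs.
Proof.
apply: lifted_EPI_facet => //; first by case/andP: hk.
move=> i; have : range a (a i) by exists i.
by rewrite ha => -[->//|->]; apply: le_trans (ltW haLH).
Qed.
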